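(* Let $UB$ be the objective function value of a feasible solution of the discrete $\alpha$-neighbor $p$-center problem. Then when adding the constraints $$x_{ij}=0\quad \forall i,j\in N,\ i\ne j,\ d_{ij}>UB$$ to (APC1), no optimal solution of (APC1) is cut off.
   Context: Discrete $\alpha$-neighbor $p$-center problem (d-$\alpha$-$p$CP): given are a finite set of points $N$, a positive integer $p<|N|$, a positive integer $\alpha\le p$, and distances $d_{ij}\ge 0$ for $i,j\in N$. A feasible solution is a set $P\subseteq N$ with $|P|=p$ (open facilities). For $i\in N\setminus P$ let $d_\alpha(P,i)=\min_{A\subseteq P,|A|=\alpha}\max_{j\in A} d_{ij}$, and let $f_\alpha(P)=\max_{i\in N\setminus P} d_\alpha(P,i)$ be the objective function value of $P$. The problem is $\min_{P\subseteq N,|P|=p} f_\alpha(P)$. Formulation (APC1), in variables $y_j$ ($j\in N$), $x_{ij}$ ($i,j\in N$, $i\ne j$), $z$: minimize $z$ subject to - $\sum_{j\in N} y_j = p$; - $\sum_{j\in N\setminus\{i\}} x_{ij}=\alpha(1-y_i)$ for all $i\in N$; - $x_{ij}\le y_j$ for all $i,j\in N$, $i\ne j$; - $d_{ij}x_{ij}\le z$ for all $i,j\in N$, $i\neq j$; - $x_{ij}\in\{0,1\}$ for all $i,j\in N$, $i\ne j$; $y_j\in\{0,1\}$ for all $j\in N$; $z\in\mathbb{R}$. *)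

(* Defs.v *)
From mathcomp Require Import all_boot all_order all_algebra.
From mathcomp Require Import reals.

Set Implicit Arguments.
Unset Strict Implicit.
Unset Printing Implicit Defensive.

Import Order.TTheory GRing.Theory Num.Theory.
Local Open Scope ring_scope.

(* Minimum and maximum of a nonempty list of reals (0 on the empty list):
   the head serves as initial value, so no sentinel enters the result. *)
Definition seq_min (R : realType) (s : seq R) : R :=
  \big[Num.min/head 0 s]_(v <- s) v.

Definition seq_max (R : realType) (s : seq R) : R :=
  \big[Num.max/head 0 s]_(v <- s) v.

Lemma seq_minP (R : realType) (s : seq R) : s != [::] ->
  seq_min s \in s /\ {in s, forall v, seq_min s <= v}.
Proof.
move=> s0; have h0 : head 0 s \in s by case: s s0 => //= a s _; rewrite mem_head.
rewrite /seq_min; move: (head 0 s) h0 => a ha; split; last first.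
  elim: s {s0 ha} => [//|b s IH] v; rewrite big_cons inE ge_min.
  by case/predU1P => [->|/IH ->]; rewrite ?lexx ?orbT.
rewrite big_seq; elim/big_ind: _ => // u v; rewrite /Num.min; by case: ifP.
Qed.

Lemma seq_maxP (R : realType) (s : seq R) : s != [::] ->
  seq_max s \in s /\ {in s, forall v, v <= seq_max s}.
Proof.
move=> s0; have h0 : head 0 s \in s by case: s s0 => //= a s _; rewrite mem_head.
rewrite /seq_max; move: (head 0 s) h0 => a ha; split; last first.
  elim: s {s0 ha} => [//|b s IH] v; rewrite big_cons inE le_max.
  by case/predU1P => [->|/IH ->]; rewrite ?lexx ?orbT.
rewrite big_seq; elim/big_ind: _ => // u v; rewrite /Num.max; by case: ifP.
Qed.

Definition dapcp_feasible (N : finType) (p : nat) (P : {set N}) : Prop :=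
  #|P| = p.

Definition d_alpha (R : realType) (N : finType) (d : N -> N -> R)
    (alpha : nat) (P : {set N}) (i : N) : R :=
  seq_min [seq seq_max [seq d i j | j in A]
          | A : {set N} in [set A : {set N} | (A \subset P) && (#|A| == alpha)]].

Definition f_alpha (R : realType) (N : finType) (d : N -> N -> R)
    (alpha : nat) (P : {set N}) : R :=
  seq_max [seq d_alpha d alpha P i | i in ~: P].

(* The variables x_ij exist only for i != j: the diagonal values of [x] are
   not part of the model and occur in no constraint. *)
Definition apc1_feasible (R : realType) (N : finType) (d : N -> N -> R)
    (p alpha : nat) (x : N -> N -> R) (y : N -> R) (z : R) : Prop :=
  [/\ \sum_(j : N) y j = p%:R,
      forall i, \sum_(j : N | j != i) x i j = alpha%:R * (1 - y i),
      forall i j, i != j -> x i j <= y j,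
      forall i j, i != j -> d i j * x i j <= z
    & (forall i j, i != j -> x i j = 0 \/ x i j = 1) /\
      (forall j, y j = 0 \/ y j = 1)].

Definition apc1_optimal (R : realType) (N : finType) (d : N -> N -> R)
    (p alpha : nat) (x : N -> N -> R) (y : N -> R) (z : R) : Prop :=
  apc1_feasible d p alpha x y z /\
  forall x' y' z', apc1_feasible d p alpha x' y' z' -> z <= z'.

Definition apc1_UB_feasible (R : realType) (N : finType) (d : N -> N -> R)
    (p alpha : nat) (UB : R) (x : N -> N -> R) (y : N -> R) (z : R) : Prop :=
  apc1_feasible d p alpha x y z /\
  (forall i j, i != j -> UB < d i j -> x i j = 0).

(* Main.v *)
Require Import Defs.
From mathcomp Require Import all_boot all_order all_algebra.
From mathcomp Require Import reals.

(** Every feasible solution [P] of the location problem yields a feasible point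
    of the integer program whose objective value is [f_alpha d alpha P]: open
    exactly the facilities of [P] and assign each closed site to [alpha]
    facilities realising its [alpha]-neighbor distance
    ([apc1_feasible_of_solution]).  Hence the optimal value [z] is at most [UB].
    In an optimal solution an assignment [x i j = 1] forces [d i j <= z <= UB],
    so that no pair with [UB < d i j] can be assigned. *)

Set Implicit Arguments.
Unset Strict Implicit.
Unset Printing Implicit Defensive.

Import Order.TTheory GRing.Theory Num.Theory.
Local Open Scope ring_scope.

(** The minimum defining [d_alpha] ranges over a nonempty family as soon as
    [P] has [alpha] elements, hence is attained by some [A]. *)
Lemma d_alpha_attained (R : realType) (N : finType) (d : N -> N -> R)
    (alpha : nat) (P : {set N}) (i : N) : (alpha <= #|P|)%N ->
  exists A : {set N}, [/\ A \subset P, #|A| = alpha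
                        & {in A, forall j, d i j <= d_alpha d alpha P i}].
Proof.
move=> leaP; rewrite /d_alpha; set s := (X in seq_min X).
have s_neq0 : s != [::].
  by rewrite -size_eq0 size_image cards_draws -lt0n bin_gt0.
have [/imageP[A] + -> _] := seq_minP s_neq0.
rewrite inE => /andP[sAP /eqP cardA]; exists A; split=> // j Aj.
have dj : d i j \in [seq d i k | k in A] by apply: image_f.
have dA_neq0 : [seq d i k | k in A] != [::] by case: [seq _ | _ in _] dj.
by have [_] := seq_maxP dA_neq0; apply.
Qed.

Lemma d_alpha_le_f_alpha (R : realType) (N : finType) (d : N -> N -> R)
    (alpha : nat) (P : {set N}) (i : N) : i \notin P ->
  d_alpha d alpha P i <= f_alpha d alpha P.
Proof.
move=> iP; rewrite /f_alpha; set s := (X in seq_max X).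
have si : d_alpha d alpha P i \in s by apply: image_f; rewrite inE.
have s_neq0 : s != [::] by case: s si.
by have [_] := seq_maxP s_neq0; apply.
Qed.

(** A pair with [x i j = 0] turns the constraint [d i j * x i j <= z] into
    [0 <= z]; this bound is what makes [f_alpha d alpha P] a valid value of [z]
    there. Some site is closed because [#|P| < #|N|], and its [d_alpha]
    dominates a distance because [alpha] is positive. *)
Lemma f_alpha_ge0 (R : realType) (N : finType) (d : N -> N -> R)
    (alpha : nat) (P : {set N}) :
  (forall i j, 0 <= d i j) -> (0 < alpha <= #|P|)%N -> (#|P| < #|N|)%N ->
  0 <= f_alpha d alpha P.
Proof.
move=> d_ge0 /andP[alpha_gt0 leaP] ltPN.
have /card_gt0P[i] : (0 < #|~: P|)%N by rewrite cardsCs setCK subn_gt0.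
rewrite inE => /(d_alpha_le_f_alpha d alpha); apply: le_trans.
have [A [_ cardA dA]] := d_alpha_attained d i leaP.
have /card_gt0P[j Aj] : (0 < #|A|)%N by rewrite cardA.
exact: le_trans (d_ge0 i j) (dA j Aj).
Qed.

(** Take [y] the indicator of [P], and let each closed site [i] be assigned to
    a set [A i] attaining [d_alpha d alpha P i]; every distance used is then at
    most [d_alpha d alpha P i], hence at most [f_alpha d alpha P]. *)
Lemma apc1_feasible_of_solution (R : realType) (N : finType)
    (d : N -> N -> R) (p alpha : nat) (P : {set N}) :
  (forall i j, 0 <= d i j) -> (0 < alpha <= p)%N -> (p < #|N|)%N ->
  dapcp_feasible p P ->
  exists x y, apc1_feasible d p alpha x y (f_alpha d alpha P).
Proof.
move=> d_ge0 alpha_bnd ltpN cardP.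
have f_ge0 : 0 <= f_alpha d alpha P by apply: f_alpha_ge0; rewrite ?cardP.
have leaP : (alpha <= #|P|)%N by rewrite cardP; case/andP: alpha_bnd.
have [A AP] := fin_all_exists (fun i => d_alpha_attained d i leaP).
exists (fun i j => ((i \notin P) && (j \in A i))%:R), (fun j => (j \in P)%:R).
split=> [|i|i j _|i j _|]; last first.
- by split=> [i j _|j]; [case: (_ && _)|case: (_ \in _)]; [right|left|right|left].
- case: andP => [[iP Aj]|_]; last by rewrite mulr0.
  rewrite mulr1; have [_ _ dA] := AP i.
  exact: le_trans (dA j Aj) (d_alpha_le_f_alpha d alpha iP).
- rewrite ler_nat; case: andP => // -[_ Aj].
  by have [/subsetP/(_ j Aj) ->] := AP i.
- have [iP|iP] /= := boolP (i \in P); first by rewrite big1 // subrr mulr0.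
  have [/subsetP sAP cardA _] := AP i.
  (* A closed site is not one of its own neighbors, so excluding the diagonal
     term loses nothing. *)
  have iA : i \notin A i by apply: contra iP; apply: sAP.
  rewrite subr0 mulr1 -natr_sum -cardA -sum1_card [in RHS]big_mkcond /=.
  rewrite [in RHS](bigD1 i) //= (negbTE iA) add0n.
  by congr _%:R; apply: eq_bigr => j _; case: (j \in A i).
- rewrite -natr_sum -cardP -sum1_card [in RHS]big_mkcond /=.
  by congr _%:R; apply: eq_bigr => j _; case: (j \in P).
Qed.

Theorem theorem4 (R : realType) (N : finType) (d : N -> N -> R)
    (p alpha : nat)
    (hd : forall i j, 0 <= d i j)
    (hp0 : (0 < p)%N) (hpN : (p < #|N|)%N)
    (ha0 : (0 < alpha)%N) (hap : (alpha <= p)%N)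
    (P : {set N}) (hP : dapcp_feasible p P)
    (UB : R) (hUB : UB = f_alpha d alpha P)
    (x : N -> N -> R) (y : N -> R) (z : R) :
  apc1_optimal d p alpha x y z -> apc1_UB_feasible d p alpha UB x y z.
Proof.
move=> [feas opt]; split=> // i j neq_ij ltUBd.
have [_ _ _ dx_le_z [x01 _]] := feas.
case: (x01 i j neq_ij) => // xij1.
have [|x' [y' feasP]] := apc1_feasible_of_solution hd _ hpN hP (alpha := alpha).
  by rewrite ha0.
have := le_trans (dx_le_z i j neq_ij) (opt _ _ _ feasP).
by rewrite xij1 mulr1 -hUB leNgt ltUBd.
Qed.
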